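(* $\mathbf{tHC}$ is sound and complete with respect to the class of finite $Z$-rooted temporal transits.
   Context: Write $\mathsf{P}$ for the ''past diamond'' operator (black diamond). $\mathbf{mHC}$ is the smallest set of formulas in $\wedge,\vee,\to,\Box,\bot,\top$ containing intuitionistic propositional logic and $\Box(p\to q)\to(\Box p\to\Box q)$, $p\to\Box p$, $\Box p\to(q\vee(q\to p))$, closed under modus ponens and uniform substitution. $\mathbf{tHC}$ is the smallest set of formulas in the language extended with $\mathsf{P}$ containing $\mathbf{mHC}$ and $\mathsf{P}(p\vee q)\to(\mathsf{P}p\vee\mathsf{P}q)$, $\mathsf{P}\bot\to\bot$, $p\to\Box\mathsf{P}p$, $\mathsf{P}\Box p\to p$, closed under modus ponens, uniform substitution and the rule from $\varphi\to\chi$ infer $\mathsf{P}\varphi\to\mathsf{P}\chi$. A temporal transit is $(X,R^{\lhd},R^{\rhd},\le)$ where $\le$ is a partial order equal to the reflexive closure of $R^{\rhd}$ and $R^{\lhd}$ is the inverse of $R^{\rhd}$; semantics uses valuations into upsets, intuitionistic $\to$ via $\le$, $x\models\Box\varphi$ iff $\varphi$ holds at all $R^{\rhd}$-successors, $x\models\mathsf{P}\varphi$ iff $\varphi$ holds at some $w$ with $xR^{\lhd}w$. On a finite temporal transit, let $\mathrm{Refl}$ be the $R^{\rhd}$-reflexive points, $xBw$ iff $w\le x$ and $(w,x]\cap\mathrm{Refl}=\varnothing$, $Z_0=$ identity, $Z_{n+1}=Z_n;B;\le$, $Z=\bigcup_nZ_n$; the frame is $Z$-rooted if there is $x$ with $xZy$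 for all $y$. *)

(* Defs.v *)
From mathcomp Require Import all_boot.

Set Implicit Arguments.
Unset Strict Implicit.
Unset Printing Implicit Defensive.

Inductive form : Type :=
| Var of nat
| Bot
| Top
| And of form & form
| Or of form & form
| Imp of form & form
| Box of form
| Past of form.

Fixpoint subst (s : nat -> form) (phi : form) : form :=
  match phi with
  | Var n => s n
  | Bot => Bot
  | Top => Top
  | And a b => And (subst s a) (subst s b)
  | Or a b => Or (subst s a) (subst s b)
  | Imp a b => Imp (subst s a) (subst s b)
  | Box a => Box (subst s a)
  | Past a => Past (subst s a)
  end.

(* The sublanguage without Past: the language of mHC. *)
Fixpoint past_free (phi : form) : bool :=
  match phi with
  | Var _ | Bot | Top => true
  | And a b | Or a b | Imp a b => past_free a && past_free b
  | Box a => past_free a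
  | Past _ => false
  end.

(* The sublanguage without Box and Past: the language of IPC. *)
Fixpoint modality_free (phi : form) : bool :=
  match phi with
  | Var _ | Bot | Top => true
  | And a b | Or a b | Imp a b => modality_free a && modality_free b
  | Box _ | Past _ => false
  end.

Declare Scope form_scope.
Delimit Scope form_scope with form.
Bind Scope form_scope with form.
Infix "∧'" := And (at level 40, left associativity) : form_scope.
Infix "∨'" := Or (at level 50, left associativity) : form_scope.
Infix "→'" := Imp (at level 60, right associativity) : form_scope.

(* Axioms are single formulas in these three distinct variables; their
   instances come from the rule of uniform substitution. *)
Local Notation p := (Var 0).
Local Notation q := (Var 1).
Local Notation r := (Var 2).

(* In IPC and mHC, uniform substitution is relative to the respective
   sublanguage, so that all members of these sets lie in that sublanguage. *)
Inductive IPC : form -> Prop :=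
| IPC_K : IPC (p →' q →' p)
| IPC_S : IPC ((p →' q →' r) →' (p →' q) →' p →' r)
| IPC_and_l : IPC (p ∧' q →' p)
| IPC_and_r : IPC (p ∧' q →' q)
| IPC_and_i : IPC (p →' q →' p ∧' q)
| IPC_or_l : IPC (p →' p ∨' q)
| IPC_or_r : IPC (q →' p ∨' q)
| IPC_or_e : IPC ((p →' r) →' (q →' r) →' p ∨' q →' r)
| IPC_bot : IPC (Bot →' p)
| IPC_top : IPC Top
| IPC_mp phi chi : IPC (phi →' chi) -> IPC phi -> IPC chi
| IPC_us s phi :
    (forall n, modality_free (s n)) -> IPC phi -> IPC (subst s phi).

Inductive mHC : form -> Prop :=
| mHC_IPC phi : IPC phi -> mHC phi
| mHC_box_K : mHC (Box (p →' q) →' Box p →' Box q)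
| mHC_box_intro : mHC (p →' Box p)
| mHC_box_or : mHC (Box p →' q ∨' (q →' p))
| mHC_mp phi chi : mHC (phi →' chi) -> mHC phi -> mHC chi
| mHC_us s phi :
    (forall n, past_free (s n)) -> mHC phi -> mHC (subst s phi).

Inductive tHC : form -> Prop :=
| tHC_mHC phi : mHC phi -> tHC phi
| tHC_past_or : tHC (Past (p ∨' q) →' Past p ∨' Past q)
| tHC_past_bot : tHC (Past Bot →' Bot)
| tHC_box_past : tHC (p →' Box (Past p))
| tHC_past_box : tHC (Past (Box p) →' p)
| tHC_mp phi chi : tHC (phi →' chi) -> tHC phi -> tHC chi
| tHC_us s phi : tHC phi -> tHC (subst s phi)
| tHC_past_mono phi chi : tHC (phi →' chi) -> tHC (Past phi →' Past chi).

(* [Rpast] is the relation written with a left triangle, [Rfut] the one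
   written with a right triangle. *)
Record temporal_transit (X : Type) : Type := TemporalTransit {
  Rpast : X -> X -> Prop;
  Rfut : X -> X -> Prop;
  le : X -> X -> Prop;
  le_refl : forall x, le x x;
  le_trans : forall x y z, le x y -> le y z -> le x z;
  le_anti : forall x y, le x y -> le y x -> x = y;
  le_refl_closure : forall x y, le x y <-> x = y \/ Rfut x y;
  Rpast_inverse : forall x y, Rpast x y <-> Rfut y x
}.

Section Semantics.
Variables (X : Type) (F : temporal_transit X).

Definition upset (U : X -> Prop) : Prop :=
  forall x y, le F x y -> U x -> U y.

Fixpoint forces (V : nat -> X -> Prop) (x : X) (phi : form) : Prop :=
  match phi with
  | Var n => V n x
  | Bot => False
  | Top => True
  | And a b => forces V x a /\ forces V x b
  | Or a b => forces V x a \/ forces V x b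
  | Imp a b => forall y, le F x y -> forces V y a -> forces V y b
  | Box a => forall y, Rfut F x y -> forces V y a
  | Past a => exists w, Rpast F x w /\ forces V w a
  end.

Definition valid (phi : form) : Prop :=
  forall V : nat -> X -> Prop, (forall n, upset (V n)) ->
  forall x, forces V x phi.

Definition Refl (x : X) : Prop := Rfut F x x.

(* [v] in the half-open interval (w, x]. *)
Definition in_Ioc (w x v : X) : Prop := le F w v /\ w <> v /\ le F v x.

Definition B (x w : X) : Prop :=
  le F w x /\ forall v, in_Ioc w x v -> ~ Refl v.

Fixpoint Zn (n : nat) (x y : X) : Prop :=
  match n with
  | 0 => x = y
  | n'.+1 => exists u v, [/\ Zn n' x u, B u v & le F v y]
  end.

Definition Z (x y : X) : Prop := exists n, Zn n x y.

Definition Z_rooted : Prop := exists x, forall y, Z x y.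

End Semantics.

(* Main.v *)
(** Completeness goes through a filtration of the canonical model.  Points of
    the canonical model are prime theories, ordered by inclusion, and the
    axioms of tHC make it a temporal transit.  Its traces on the subformulas of
    [phi], related by the transitive closure of the least filtration, form a
    finite transit refuting [phi]: inclusion of traces along the closure gives
    antisymmetry, and [p -> Box p] lets [Box] survive the closure.

    Restricting a finite transit to the points [Z]-reachable from a point [x]
    preserves forcing.  The only delicate case is [Past a] at [y], witnessed by
    some [w]: if the interval (w, y] contains a reflexive point, a maximal such
    [v] is [B]-related to [y] and, by persistence, still witnesses [Past a]. *)

Require Import Defs.
From HB Require Import structures.
From mathcomp Require Import all_boot.
From Stdlib Require Import Classical ClassicalEpsilon Relation_Operators.

Set Implicit Arguments.
Unset Strict Implicit.
Unset Printing Implicit Defensive.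

Local Open Scope form_scope.

Definition decide (P : Prop) : bool :=
  if excluded_middle_informative P then true else false.

Lemma decideP (P : Prop) : reflect P (decide P).
Proof. by rewrite /decide; case: excluded_middle_informative => h; constructor. Qed.

Lemma eq_decide (P Q : Prop) : decide P = decide Q -> (P <-> Q).
Proof. by case: decideP; case: decideP. Qed.

(** * Soundness *)

Section Frames.
Variables (X : Type) (F : temporal_transit X).

Lemma Rfut_le x y : Rfut F x y -> le F x y.
Proof. by move=> xy; apply/le_refl_closure; right. Qed.

(** Only [x = z] needs an argument: antisymmetry then gives [x = y], so the given step is already
    the required loop. *)
Lemma Rfut_le_trans x y z : Rfut F x y -> le F y z -> Rfut F x z.
Proof.
move=> xy yz; have xz := le_trans (Rfut_le xy) yz.
case/le_refl_closure: (xz) => // exz; subst z.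
by rewrite {2}(le_anti (Rfut_le xy) yz).
Qed.

Lemma le_Rfut_trans x y z : le F x y -> Rfut F y z -> Rfut F x z.
Proof.
by case/le_refl_closure=> [->//|xy] /Rfut_le; apply: Rfut_le_trans.
Qed.

Lemma forces_upset V phi :
  (forall n, upset F (V n)) -> upset F (fun x => forces F V x phi).
Proof.
move=> upV; rewrite /upset; elim: phi => //=.
- by move=> a IHa b IHb x y xy [xa xb]; split; [apply: IHa xa|apply: IHb xb].
- by move=> a IHa b IHb x y xy [xa|xb]; [left; apply: IHa xa|right; apply: IHb xb].
- by move=> a IHa b IHb x y xy h z yz; apply: h; apply: le_trans yz.
- by move=> a IHa x y xy h z yz; apply: h; apply: le_Rfut_trans yz.
- move=> a IHa x y xy [w [/Rpast_inverse wx wa]]; exists w; split=> //.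
  by apply/Rpast_inverse; apply: Rfut_le_trans xy.
Qed.

Lemma forces_subst V s x phi :
  forces F V x (subst s phi) <->
  forces F (fun n y => forces F V y (s n)) x phi.
Proof.
elim: phi x => //=.
- by move=> a IHa b IHb x; rewrite IHa IHb.
- by move=> a IHa b IHb x; rewrite IHa IHb.
- by move=> a IHa b IHb x; split=> h y xy /IHa ya; apply/IHb; apply: h.
- by move=> a IHa x; split=> h y xy; apply/IHa; apply: h.
- by move=> a IHa x; split=> -[w [xw /IHa wa]]; exists w.
Qed.

Lemma valid_mp phi chi : valid F (phi →' chi) -> valid F phi -> valid F chi.
Proof. by move=> hi h V upV x; apply: (hi V upV x x (le_refl F x)); apply: h. Qed.

(** By persistence, sending each variable to the truth set of its substitute is again a valuation
    into upsets. *)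
Lemma valid_subst s phi : valid F phi -> valid F (subst s phi).
Proof.
move=> h V upV x; apply/forces_subst; apply: h => n.
exact: forces_upset.
Qed.

Lemma valid_IPC phi : IPC phi -> valid F phi.
Proof.
elim=> {phi} [||||||||||phi chi _ hi _ h|s phi _ _ h].
- by move=> V upV x /= y xy yp z yz zq; apply: (upV 0) yp.
- move=> V upV x /= y xy hpqr z yz hpq t zt tp.
  by apply: (hpqr t (le_trans yz zt) tp t (le_refl F t)); apply: hpq.
- by move=> V upV x /= y xy [].
- by move=> V upV x /= y xy [].
- by move=> V upV x /= y xy yp z yz zq; split=> //; apply: (upV 0) yp.
- by move=> V upV x /= y xy yp; left.
- by move=> V upV x /= y xy yq; right.
- move=> V upV x /= y xy hp z yz hq t zt [tp|tq]; last exact: hq.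
  exact: hp (le_trans yz zt) tp.
- by move=> V upV x y xy [].
- by [].
- exact: valid_mp hi h.
- exact: valid_subst.
Qed.

Lemma valid_mHC phi : mHC phi -> valid F phi.
Proof.
elim=> {phi} [phi|||| phi chi _ hi _ h|s phi _ _ h].
- exact: valid_IPC.
- move=> V upV x /= y xy hpq z yz hp t zt.
  by apply: (hpq t (le_Rfut_trans yz zt) t (le_refl F t)); apply: hp.
- by move=> V upV x /= y xy yp z /Rfut_le yz; apply: (upV 0) yp.
(* If [q] fails at [y], any point above [y] forcing [q] differs from [y], hence is an
   [Rfut]-successor, where [p] holds. *)
- move=> V upV x /= y xy hp; case: (classic (V 1 y)) => [|nq]; first by left.
  right=> z /le_refl_closure[<- //|yz _]; exact: hp.
- exact: valid_mp hi h.
- exact: valid_subst.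
Qed.

Lemma valid_tHC phi : tHC phi -> valid F phi.
Proof.
elim=> {phi} [phi||||| phi chi _ hi _ h|s phi _ h|phi chi _ h].
- exact: valid_mHC.
- by move=> V upV x /= y xy [w [yw [wp|wq]]]; [left|right]; exists w.
- by move=> V upV x /= y xy [w []].
- by move=> V upV x /= y xy yp z yz; exists y; split=> //; apply/Rpast_inverse.
- by move=> V upV x /= y xy [w [/Rpast_inverse wy]]; apply.
- exact: valid_mp hi h.
- exact: valid_subst.
- move=> V upV x /= y xy [w [yw wphi]]; exists w; split=> //.
  exact: (h V upV w w (le_refl F w)).
Qed.

End Frames.

(** * Restriction to the points Z-reachable from a given one *)

(** Take a point of [Q] with the most points below it; a strictly larger one would have all of these
    and itself below it. *)
Lemma finite_maximal (X : finType) (F : temporal_transit X) (Q : X -> Prop) x :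
  Q x -> exists2 m, Q m & forall y, Q y -> le F m y -> y = m.
Proof.
move=> Qx; pose below y := #|[pred u | decide (le F u y)]|.
have dQx : decide (Q x) by apply/decideP.
case: (@arg_maxnP X x (fun y => decide (Q y)) below dQx) => m /decideP Qm mmax.
exists m => // y Qy my; apply: le_anti (my).
have {}mmax : below y <= below m by apply: mmax; apply/decideP.
apply: NNPP => nym; move: mmax; apply/negP; rewrite -ltnNge.
apply: proper_card; apply/properP; split.
  by apply/subsetP=> u; rewrite !inE => /decideP um; apply/decideP; apply: le_trans my.
exists y; first by rewrite inE; apply/decideP; apply: le_refl.
by rewrite inE; apply/decideP.
Qed.

(** If (w, x] has no reflexive point, [w] itself serves; otherwise a maximal reflexive one does, and
    its loop gives [Rfut v x] even when [v = x]. *)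
Lemma Rfut_B_witness (X : finType) (F : temporal_transit X) w x :
  Rfut F w x -> exists v, [/\ B F x v, Rfut F v x & le F w v].
Proof.
move=> wx; have lewx := Rfut_le wx.
case: (classic (exists v, in_Ioc F w x v /\ Refl F v)) => [[v0 Qv0]|none]; last first.
  exists w; split=> //; last exact: le_refl.
  by split=> // v vin vr; apply: none; exists v.
have [v [[wv [nwv vx]] vr] vmax] :=
  @finite_maximal X F (fun v => in_Ioc F w x v /\ Refl F v) v0 Qv0.
exists v; split=> //; last exact: Rfut_le_trans vx.
split=> // u [vu [nvu ux]] ur; apply: nvu; apply/esym/vmax => //.
split=> //; split; first exact: le_trans vu.
by split=> // ewu; apply: nwv; apply: (le_anti wv); rewrite ewu.
Qed.

Section Restriction.
Variables (X : finType) (F : temporal_transit X) (x0 : X).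

(** Deciding reachability classically keeps the restricted carrier a [finType]. *)
Definition reachable : finType := {x : X | decide (Z F x0 x)}.

Definition mk_reachable x (h : Z F x0 x) : reachable :=
  exist _ x (introT (decideP _) h).

Lemma reachableP (y : reachable) : Z F x0 (val y).
Proof. exact: elimT (decideP _) (valP y). Qed.

Definition reachable_transit : temporal_transit reachable.
Proof.
refine (@TemporalTransit reachable
  (fun x y => Rpast F (val x) (val y)) (fun x y => Rfut F (val x) (val y))
  (fun x y => le F (val x) (val y)) _ _ _ _ _).
- by move=> x; apply: le_refl.
- by move=> x y z; apply: le_trans.
- by move=> x y xy yx; apply/val_inj; apply: le_anti xy yx.
- move=> x y; rewrite le_refl_closure; split=> -[h|h]; try by right.
    by left; apply/val_inj.
  by left; rewrite h.
- by move=> x y; apply: Rpast_inverse.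
Defined.

(** [B] is reflexive because (x, x] is empty, so one further [Z]-step absorbs [le]. *)
Lemma Z_le x y : Z F x0 x -> le F x y -> Z F x0 y.
Proof.
case=> n nx xy; exists n.+1, x, x; split=> //; split; first exact: le_refl.
by move=> v [xv [nxv vx]] _; apply: nxv; apply: le_anti xv vx.
Qed.

Lemma Z_B x y : Z F x0 x -> B F x y -> Z F x0 y.
Proof. by case=> n nx xy; exists n.+1, x, y; split=> //; apply: le_refl. Qed.

Lemma Z_refl : Z F x0 x0.
Proof. by exists 0. Qed.

(** All intermediate points of a [Z]-path from [x0] are reachable, and [B] persists because
    intervals only lose points. *)
Lemma reachable_transit_Z_rooted : Z_rooted reachable_transit.
Proof.
exists (mk_reachable Z_refl) => y; case: (reachableP y) => n h; exists n.
elim: n y h => [|n IHn] y /=; first by move=> h; apply: val_inj.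
case=> u [v [nu uv vy]].
have Zu : Z F x0 u by exists n.
exists (mk_reachable Zu), (mk_reachable (Z_B Zu uv)); split=> //.
  exact: IHn.
have [vu nr] := uv; split=> // t [vt [nvt tu]]; apply: nr.
by split=> //; split=> // evt; apply: nvt; apply: val_inj.
Qed.

Lemma forces_reachable V phi (y : reachable) :
  (forall n, upset F (V n)) ->
  forces reachable_transit (fun n x => V n (val x)) y phi <->
  forces F V (val y) phi.
Proof.
move=> upV; elim: phi y => //=.
- by move=> a IHa b IHb y; rewrite IHa IHb.
- by move=> a IHa b IHb y; rewrite IHa IHb.
- move=> a IHa b IHb y; split=> h z yz za; last by apply/IHb/h => //; apply/IHa.
  pose z' := mk_reachable (Z_le (reachableP y) yz).
  by apply/(IHb z')/h => //; apply/IHa.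
- move=> a IHa y; split=> h z yz; last by apply/IHa/h.
  by apply/(IHa (mk_reachable (Z_le (reachableP y) (Rfut_le yz))))/h.
- move=> a IHa y; split=> -[w [yw wa]]; first by exists (val w); split=> //; apply/IHa.
  move/Rpast_inverse/Rfut_B_witness: yw => [v [yv vy wv]].
  exists (mk_reachable (Z_B (reachableP y) yv)); split; first exact/Rpast_inverse.
  by apply/IHa; apply: forces_upset wv wa.
Qed.

End Restriction.

Lemma Z_rooted_valid phi :
  (forall (X : finType) (F : temporal_transit X), Z_rooted F -> valid F phi) ->
  forall (X : finType) (F : temporal_transit X), valid F phi.
Proof.
move=> h X F V upV x; pose x' := mk_reachable (@Z_refl X F x).
apply/(forces_reachable phi x' upV).
apply: (h _ _ (reachable_transit_Z_rooted F x)) => n y z yz; exact: upV.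
Qed.

(** * Prime theories *)

(** Coding by trees makes [form] countable: the enumeration drives the prime extension, and the
    equality test supports lists of subformulas. *)
Fixpoint form_tree (phi : form) : GenTree.tree nat :=
  match phi with
  | Var n => GenTree.Leaf n
  | Bot => GenTree.Node 0 [::]
  | Top => GenTree.Node 1 [::]
  | And a b => GenTree.Node 2 [:: form_tree a; form_tree b]
  | Or a b => GenTree.Node 3 [:: form_tree a; form_tree b]
  | Imp a b => GenTree.Node 4 [:: form_tree a; form_tree b]
  | Box a => GenTree.Node 5 [:: form_tree a]
  | Past a => GenTree.Node 6 [:: form_tree a]
  end.

Fixpoint tree_form (t : GenTree.tree nat) : form :=
  match t with
  | GenTree.Leaf n => Var n
  | GenTree.Node 0 _ => Bot
  | GenTree.Node 2 [:: a; b] => And (tree_form a) (tree_form b)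
  | GenTree.Node 3 [:: a; b] => Or (tree_form a) (tree_form b)
  | GenTree.Node 4 [:: a; b] => Imp (tree_form a) (tree_form b)
  | GenTree.Node 5 [:: a] => Box (tree_form a)
  | GenTree.Node 6 [:: a] => Past (tree_form a)
  (* The default also decodes [Node 1], the code of [Top]. *)
  | _ => Top
  end.

Lemma form_treeK : cancel form_tree tree_form.
Proof. by elim=> //= [a -> b ->|a -> b ->|a -> b ->|a ->|a ->]. Qed.

HB.instance Definition _ := Countable.copy form (can_type form_treeK).

(** * Instances of the axioms *)

Definition inst (a b c : form) (n : nat) : form := nth Bot [:: a; b; c] n.

(** Substitution takes place in [tHC], since [IPC] and [mHC] admit only substitutes from their own
    sublanguages. *)
Lemma tHC_IPC a b c phi : IPC phi -> tHC (subst (inst a b c) phi).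
Proof. by move=> h; apply: tHC_us; apply: tHC_mHC; apply: mHC_IPC. Qed.

Lemma tHC_K a b : tHC (a →' b →' a).
Proof. exact: (tHC_IPC a b Bot IPC_K). Qed.

Lemma tHC_S a b c : tHC ((a →' b →' c) →' (a →' b) →' a →' c).
Proof. exact: (tHC_IPC a b c IPC_S). Qed.

Lemma tHC_or_l a b : tHC (a →' a ∨' b).
Proof. exact: (tHC_IPC a b Bot IPC_or_l). Qed.

Lemma tHC_or_r a b : tHC (b →' a ∨' b).
Proof. exact: (tHC_IPC a b Bot IPC_or_r). Qed.

Lemma tHC_or_e a b c : tHC ((a →' c) →' (b →' c) →' a ∨' b →' c).
Proof. exact: (tHC_IPC a b c IPC_or_e). Qed.

Lemma tHC_and_l a b : tHC (a ∧' b →' a).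
Proof. exact: (tHC_IPC a b Bot IPC_and_l). Qed.

Lemma tHC_and_r a b : tHC (a ∧' b →' b).
Proof. exact: (tHC_IPC a b Bot IPC_and_r). Qed.

Lemma tHC_and_i a b : tHC (a →' b →' a ∧' b).
Proof. exact: (tHC_IPC a b Bot IPC_and_i). Qed.

Lemma tHC_bot_e a : tHC (Bot →' a).
Proof. exact: (tHC_IPC a Bot Bot IPC_bot). Qed.

Lemma tHC_boxK a b : tHC (Box (a →' b) →' Box a →' Box b).
Proof. exact: (tHC_us (inst a b Bot) (tHC_mHC mHC_box_K)). Qed.

Lemma tHC_box_i a : tHC (a →' Box a).
Proof. exact: (tHC_us (inst a Bot Bot) (tHC_mHC mHC_box_intro)). Qed.

Lemma tHC_boxor a b : tHC (Box a →' b ∨' (b →' a)).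
Proof. exact: (tHC_us (inst a b Bot) (tHC_mHC mHC_box_or)). Qed.

Lemma tHC_pastor a b : tHC (Past (a ∨' b) →' Past a ∨' Past b).
Proof. exact: (tHC_us (inst a b Bot) tHC_past_or). Qed.

Lemma tHC_boxpast a : tHC (a →' Box (Past a)).
Proof. exact: (tHC_us (inst a Bot Bot) tHC_box_past). Qed.

Lemma tHC_pastbox a : tHC (Past (Box a) →' a).
Proof. exact: (tHC_us (inst a Bot Bot) tHC_past_box). Qed.

(** Modus ponens is the only closure rule: the formulas true at one point need not respect the
    monotonicity rule for [Past]. *)
Definition theory (G : form -> Prop) : Prop :=
  (forall a, tHC a -> G a) /\ (forall a b, G (a →' b) -> G a -> G b).

(** The sets that prime extensions have to avoid: formulas provably below a given one, or formulas
    whose [Past] fails at a point. *)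
Definition ideal (I : form -> Prop) : Prop :=
  [/\ I Bot, forall a b, tHC (a →' b) -> I b -> I a
    & forall a b, I a -> I b -> I (a ∨' b)].

Definition separated (G I : form -> Prop) : Prop := forall a, G a -> ~ I a.

Definition prime_theory (w : form -> Prop) : Prop :=
  [/\ theory w, ~ w Bot & forall a b, w (a ∨' b) -> w a \/ w b].

Lemma theory_tHC : theory tHC.
Proof. by split=> // a b; apply: tHC_mp. Qed.

Lemma theory_imp G a b : theory G -> tHC (a →' b) -> G a -> G b.
Proof. by case=> thm mp h; apply: mp; apply: thm. Qed.

Lemma theory_K G a b : theory G -> G b -> G (a →' b).
Proof. by move=> hG; apply: theory_imp hG (tHC_K b a). Qed.

(** This is the theory generated by [G] and [a], in the form given by the deduction theorem. *)
Lemma theory_adjoin G a : theory G -> theory (fun b => G (a →' b)).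
Proof.
move=> hG; have [thm mp] := hG; split=> [b hb|b c hbc hb].
  by apply: theory_K => //; apply: thm.
by apply: mp hb; apply: theory_imp hbc => //; apply: tHC_S.
Qed.

Lemma theory_id G a : theory G -> G (a →' a).
Proof.
move=> hG; have [thm mp] := hG.
apply: (mp (a →' a →' a)); last exact/thm/tHC_K.
apply: (mp (a →' (a →' a) →' a)); last exact/thm/tHC_K.
exact/thm/tHC_S.
Qed.

Lemma theory_trans G a b c :
  theory G -> G (a →' b) -> G (b →' c) -> G (a →' c).
Proof.
move=> hG hab hbc; have [_ mp] := theory_adjoin a hG.
by apply: mp hab; apply: theory_K.
Qed.

Lemma theory_or_e G a b c :
  theory G -> G (a →' c) -> G (b →' c) -> G (a ∨' b →' c).
Proof.
by move=> hG hac; have [_ mp] := hG; apply: mp; apply: theory_imp hac => //; apply: tHC_or_e.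
Qed.

Lemma ideal_below c : ideal (fun a => tHC (a →' c)).
Proof.
split; first exact: tHC_bot_e.
- by move=> a b; apply: theory_trans theory_tHC.
- by move=> a b; apply: theory_or_e theory_tHC.
Qed.

(** * Prime extension of a theory avoiding an ideal *)

Section PrimeExtension.
Variables G I : form -> Prop.
Hypotheses (thG : theory G) (idI : ideal I) (GI : separated G I).

(** Lindenbaum's construction: the formula with code [n'] is adjoined when the enlarged theory still
    avoids [I]. *)
Fixpoint stage (n : nat) : form -> Prop :=
  match n with
  | 0 => G
  | n'.+1 => fun b =>
      stage n' b \/
      exists a, [/\ unpickle n' = Some a,
        separated (fun c => stage n' (a →' c)) I & stage n' (a →' b)]
  end.

Definition stages (b : form) : Prop := exists n, stage n b.

Lemma stageS n : theory (stage n) ->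
  (forall b, stage n.+1 b <-> stage n b) \/
  exists2 a, separated (fun c => stage n (a →' c)) I
    & forall b, stage n.+1 b <-> stage n (a →' b).
Proof.
move=> th.
case: (classic (exists a, unpickle n = Some a /\
                separated (fun c => stage n (a →' c)) I)) => [[a [na dis]]|none].
  right; exists a => // b; split=> [[hb|[a' []]]|hb]; first exact: theory_K.
    by rewrite na => -[<-].
  by right; exists a.
left=> b; split; last by left.
by case=> // -[a [na dis _]]; case: none; exists a.
Qed.

Lemma stageP n : theory (stage n) /\ separated (stage n) I.
Proof.
elim: n => [|n [th dis]]; first by [].
case: (stageS th) => [e|[a dis' e]].
  split; last by move=> b /e; apply: dis.
  case: th => thm mp; split=> [b /thm /e //|b c /e bc /e hb]; exact/e/(mp b).
split; last by move=> b /e; apply: dis'.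
case: (theory_adjoin a th) => thm mp.
by split=> [b /thm /e //|b c /e bc /e hb]; apply/e; apply: mp hb.
Qed.

Lemma stage_mono m n b : m <= n -> stage m b -> stage n b.
Proof.
move=> /subnK <-; elim: (n - m) => [//|k IHk] hb.
by rewrite addSn; left; apply: IHk.
Qed.

Lemma theory_stages : theory stages.
Proof.
split=> [a ha|a b [m hab] [n ha]]; first by exists 0; case: thG => thm _; apply: thm.
exists (maxn m n); case: (stageP (maxn m n)) => -[_ mp] _; apply: (mp a).
  exact: stage_mono (leq_maxl _ _) hab.
exact: stage_mono (leq_maxr _ _) ha.
Qed.

(** [a] was rejected at stage [pickle a], so adjoining it there would have met [I]. *)
Lemma stages_maximal a : ~ stages a -> exists2 c, I c & stages (a →' c).
Proof.
move=> na; apply: NNPP => none; apply: na; exists (pickle a).+1 => /=; right.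
have [th _] := stageP (pickle a).
exists a; split; [exact: pickleK| |exact: theory_id].
by move=> c hc Ic; apply: none; exists c => //; exists (pickle a).
Qed.

Lemma prime_extension : exists w,
  [/\ prime_theory w, forall a, G a -> w a & separated w I].
Proof.
have dis : separated stages I by move=> a [n]; case: (stageP n) => _; apply.
have th := theory_stages; have [thm mp] := th; have [Ibot _ Ior] := idI.
exists stages; split=> //; last by move=> a ha; exists 0.
split=> [//|hbot|a b hab]; first exact: dis Ibot.
apply: NNPP => /not_or_and[na nb].
(* Two rejected disjuncts imply members [c] and [d] of [I]; their disjunction would put [c ∨' d]
   into both [stages] and [I]. *)
have [c Ic ac] := stages_maximal na; have [d Id bd] := stages_maximal nb.
apply: (dis (c ∨' d)); last exact: Ior.
apply: mp hab; apply: theory_or_e => //; apply: theory_trans th _ (thm _ _).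
- exact: ac.
- exact: tHC_or_l.
- exact: bd.
- exact: tHC_or_r.
Qed.

End PrimeExtension.

(** * The canonical model *)

Definition canonical_fut (w u : form -> Prop) : Prop := forall a, w (Box a) -> u a.

Section Canonical.
Variable w : form -> Prop.
Hypothesis pw : prime_theory w.

Let thw : theory w. Proof. by case: pw. Qed.

Lemma canonical_fut_sub u a : canonical_fut w u -> w a -> u a.
Proof. by move=> wu wa; apply: wu; apply: theory_imp wa => //; apply: tHC_box_i. Qed.

(** Proper inclusion is a successor step: as [a] is not in [w], the axiom [Box b →' a ∨' (a →' b)]
    puts [a →' b] into [w], and [u] contains [a]. *)
Lemma sub_canonical_fut u a :
  prime_theory u -> (forall b, w b -> u b) -> u a -> ~ w a -> canonical_fut w u.
Proof.
move=> [[_ mp] _ _] wu ua nwa b wb; have [_ _ por] := pw.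
have /por[//|/wu hab] : w (a ∨' (a →' b)) by apply: theory_imp wb => //; apply: tHC_boxor.
exact: mp hab ua.
Qed.

Lemma canonical_imp a b : ~ w (a →' b) ->
  exists u, [/\ prime_theory u, forall c, w c -> u c, u a & ~ u b].
Proof.
(* The first branch proves separation, by refuting a [c] common to the theory and the ideal. *)
move=> nab; have [c wc cb|u [pu wu du]] :=
  prime_extension (theory_adjoin a thw) (ideal_below b).
- by apply: nab; apply: theory_trans thw wc _; case: thw => thm _; apply: thm.
- exists u; split=> //.
  + by move=> c wc; apply: wu; apply: theory_K.
  + by apply: wu; apply: theory_id.
  + by move=> ub; apply: (du b) => //; apply: theory_id theory_tHC.
Qed.

Lemma theory_unbox : theory (fun a => w (Box a)).
Proof.
have [thm mp] := thw; split=> [a ha|a b hab].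
  by apply: thm; apply: tHC_mp (tHC_box_i a) ha.
by apply: mp; apply: theory_imp hab => //; apply: tHC_boxK.
Qed.

Lemma canonical_box a : ~ w (Box a) ->
  exists u, [/\ prime_theory u, canonical_fut w u & ~ u a].
Proof.
move=> na; have [c wc ca|u [pu wu du]] :=
  prime_extension theory_unbox (ideal_below a).
- by apply: na; apply: (theory_imp theory_unbox ca wc).
- exists u; split=> // ua; apply: (du a) => //; exact: theory_id theory_tHC.
Qed.

(** The three conditions match [Past Bot →' Bot], the monotonicity rule and the distribution of
    [Past] over [∨']. *)
Lemma ideal_not_past : ideal (fun a => ~ w (Past a)).
Proof.
have [_ nbot por] := pw; split.
- by move=> h; apply: nbot; apply: theory_imp h => //; apply: tHC_past_bot.
- move=> a b /tHC_past_mono hab nb ha; apply: nb.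
  exact: theory_imp hab ha.
- move=> a b na nb hab.
  by have /por[] : w (Past a ∨' Past b) by apply: theory_imp hab => //; apply: tHC_pastor.
Qed.

(** Extend the theory generated by [a] alone, avoiding all formulas whose [Past] is missing from
    [w]. If [Box b] is in [u], then [Past (Box b)] is in [w], hence so is [b]. *)
Lemma canonical_past a : w (Past a) ->
  exists u, [/\ prime_theory u, canonical_fut u w & u a].
Proof.
move=> ha; have [c ac nc|u [pu wu du]] :=
  prime_extension (theory_adjoin a theory_tHC) ideal_not_past.
- by apply: nc; apply: theory_imp ha => //; apply: tHC_past_mono.
- exists u; split=> //; last by apply: wu; apply: theory_id theory_tHC.
  move=> b ub; have hb : w (Past (Box b)) by apply: NNPP => /(du _ ub).
  by apply: theory_imp hb => //; apply: tHC_pastbox.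
Qed.

Lemma canonical_past_i u a : canonical_fut w u -> w a -> u (Past a).
Proof. by move=> wu wa; apply: wu; apply: theory_imp wa => //; apply: tHC_boxpast. Qed.

End Canonical.

(** * Filtration *)

Fixpoint subforms (phi : form) : seq form :=
  phi :: match phi with
         | Var _ | Bot | Top => [::]
         | And a b | Or a b | Imp a b => subforms a ++ subforms b
         | Box a | Past a => subforms a
         end.

Lemma mem_subforms phi : phi \in subforms phi.
Proof. by case: phi => *; rewrite mem_head. Qed.

Section Filtration.
Variable S : seq form.

Definition trace (w : form -> Prop) : (size S).-tuple bool :=
  [tuple of map (fun a => decide (w a)) (in_tuple S)].

Lemma trace_eq w u a : trace w = trace u -> a \in S -> (w a <-> u a).
Proof.
move=> /(congr1 val) /= /eq_in_map e aS; exact: eq_decide (e a aS).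
Qed.

Lemma trace_ext w u : (forall a, a \in S -> (w a <-> u a)) -> trace w = trace u.
Proof.
move=> e; apply: val_inj => /=; apply/eq_in_map => a /e h.
by apply/decideP/decideP => /h.
Qed.

(** On members of [S] all theories with trace [t] agree. *)
Definition holds (t : (size S).-tuple bool) (a : form) : Prop :=
  exists w, [/\ prime_theory w, t = trace w & w a].

Definition filt_step (s t : (size S).-tuple bool) : Prop :=
  exists w u, [/\ prime_theory w, prime_theory u,
    s = trace w, t = trace u & canonical_fut w u].

Definition filt_fut := clos_trans _ filt_step.

Lemma holds_trace w a :
  prime_theory w -> a \in S -> (holds (trace w) a <-> w a).
Proof.
move=> pw aS; split=> [[u [pu e ua]]|wa]; last by exists w.
exact/(trace_eq e aS).
Qed.

Lemma filt_fut_prime s t : filt_fut s t ->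
  exists w u, [/\ prime_theory w, prime_theory u, s = trace w & t = trace u].
Proof.
elim=> {s t} [s t [w [u [pw pu es et _]]]|s t v _ [w [_ [pw _ es _]]] _ [_ [u [_ pu _ ev]]]].
  by exists w, u.
by exists w, u.
Qed.

Lemma filt_fut_holds s t a : a \in S -> filt_fut s t -> holds s a -> holds t a.
Proof.
move=> aS; elim=> {s t} [s t [w [u [pw pu -> -> wu]]]|s t v _ IH1 _ IH2 /IH1 //].
move/(holds_trace pw aS) => wa; apply/(holds_trace pu aS).
exact: canonical_fut_sub wu wa.
Qed.

(** The first step of a path turns [Box a] into [a], and the later steps preserve [a]. *)
Lemma filt_fut_box s t a : a \in S -> Box a \in S ->
  filt_fut s t -> holds s (Box a) -> holds t a.
Proof.
move=> aS baS; elim=> {s t} [s t [w [u [pw pu -> -> wu]]]|s t v st IH1 tv _ /IH1].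
  by move/(holds_trace pw baS) => wa; apply/(holds_trace pu aS)/wu.
exact: filt_fut_holds.
Qed.

Lemma filt_fut_past s t a : a \in S -> Past a \in S ->
  filt_fut s t -> holds s a -> holds t (Past a).
Proof.
move=> aS paS; elim=> {s t} [s t [w [u [pw pu -> -> wu]]]|s t v st IH1 tv _ /IH1].
  move/(holds_trace pw aS) => wa; apply/(holds_trace pu paS).
  exact: canonical_past_i wu wa.
exact: filt_fut_holds.
Qed.

Definition filt_le s t : Prop := s = t \/ filt_fut s t.

Lemma filt_le_trans s t v : filt_le s t -> filt_le t v -> filt_le s v.
Proof.
case=> [-> //|st] [<-|tv]; first by right.
by right; apply: t_trans st tv.
Qed.

Lemma filt_le_anti s t : filt_le s t -> filt_le t s -> s = t.
Proof.
case=> [//|st] [//|ts]; have [w [u [pw pu es et]]] := filt_fut_prime st.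
rewrite es et; apply: trace_ext => a aS.
rewrite -(holds_trace pw aS) -(holds_trace pu aS) -es -et.
by split; apply: filt_fut_holds.
Qed.

(** All Boolean tuples are points; one that is not the trace of a prime theory is [filt_le]-related
    only to itself. *)
Definition filt_transit : temporal_transit ((size S).-tuple bool) :=
  @TemporalTransit _ (fun s t => filt_fut t s) filt_fut filt_le
    (fun s => or_introl erefl) filt_le_trans filt_le_anti
    (fun s t => iff_refl _) (fun s t => iff_refl _).

Definition filt_val (n : nat) (t : (size S).-tuple bool) : Prop :=
  Var n \in S /\ holds t (Var n).

Lemma filt_val_upset n : upset filt_transit (filt_val n).
Proof.
by move=> s t [<- //|st] [nS hs]; split=> //; apply: filt_fut_holds hs.
Qed.

(** The case split compares the theories, not their traces: a proper inclusion gives a filtration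
    step, possibly a loop. *)
Lemma canonical_le w u : prime_theory w -> prime_theory u ->
  (forall a, w a -> u a) -> filt_le (trace w) (trace u).
Proof.
move=> pw pu wu; case: (classic (exists2 a, u a & ~ w a)) => [[a ua nwa]|none].
  right; apply: t_step; exists w, u; split=> //.
  exact: (sub_canonical_fut pw pu wu ua nwa).
left; apply: trace_ext => a _; split; first exact: wu.
by move=> ua; apply: NNPP => nwa; apply: none; exists a.
Qed.

Lemma filt_truth phi w : {subset subforms phi <= S} -> prime_theory w ->
  (forces filt_transit filt_val (trace w) phi <-> w phi).
Proof.
elim: phi w => [n|||a IHa b IHb|a IHa b IHb|a IHa b IHb|a IHa|a IHa] w sub pw;
  have phiS := sub _ (mem_subforms _);
  have [thw nbot por] := pw; have [thm mp] := thw.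
- by rewrite -(holds_trace pw phiS); split=> [[]|].
- by split.
- by split=> // _; apply/thm/tHC_mHC/mHC_IPC/IPC_top.
- have subb c : c \in subforms a ++ subforms b -> c \in S.
    by move=> h; apply: sub; rewrite inE h orbT.
  rewrite /= IHa ?IHb // => [|c h|c h]; try by apply: subb; rewrite mem_cat h ?orbT.
  split=> [[wa wb]|wab]; first by apply: mp wb; apply: theory_imp wa => //; apply: tHC_and_i.
  by split; apply: theory_imp wab => //; [apply: tHC_and_l|apply: tHC_and_r].
- have subb c : c \in subforms a ++ subforms b -> c \in S.
    by move=> h; apply: sub; rewrite inE h orbT.
  rewrite /= IHa ?IHb // => [|c h|c h]; try by apply: subb; rewrite mem_cat h ?orbT.
  split=> [[h|h]|/por//]; apply: theory_imp h => //.
    exact: tHC_or_l.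
  exact: tHC_or_r.
- have subb c : c \in subforms a ++ subforms b -> c \in S.
    by move=> h; apply: sub; rewrite inE h orbT.
  have suba : {subset subforms a <= S} by move=> c h; apply: subb; rewrite mem_cat h.
  have {}subb : {subset subforms b <= S}.
    by move=> c h; apply: subb; rewrite mem_cat h orbT.
  split=> /= [h|wab t wt].
    apply: NNPP => /(canonical_imp pw)[u [pu wu ua]]; apply.
    apply/(IHb u subb pu)/h; first exact: canonical_le.
    exact/IHa.
  (* As [a →' b] lies in [S], it is carried along to a theory with trace [t], where modus ponens
     applies. *)
  have [u [pu et uab]] : exists u, [/\ prime_theory u, t = trace u & u (a →' b)].
    case: wt => [<-|wt]; first by exists w.
    by apply: filt_fut_holds phiS wt _; exists w.
  rewrite et => /(IHa u suba pu) ua; apply/(IHb u subb pu).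
  by case: pu => -[_ mpu] _ _; apply: mpu ua.
- have suba : {subset subforms a <= S} by move=> c h; apply: sub; rewrite inE h orbT.
  have aS := suba _ (mem_subforms a).
  split=> /= [h|wa t wt].
    apply: NNPP => /(canonical_box pw)[u [pu wu]]; apply.
    by apply/(IHa u suba pu)/h; apply: t_step; exists w, u.
  have [u [pu -> ua]] : holds t a by apply: filt_fut_box aS phiS wt _; exists w.
  exact/IHa.
- have suba : {subset subforms a <= S} by move=> c h; apply: sub; rewrite inE h orbT.
  have aS := suba _ (mem_subforms a).
  split=> /= [[s [sw sa]]|/(canonical_past pw)[u [pu uw ua]]].
    (* A predecessor in the filtration is the trace of a prime theory, so the induction hypothesis
       applies to it. *)
    have [u [_ [pu _ es _]]] := filt_fut_prime sw.
    apply/(holds_trace pw phiS); apply: filt_fut_past aS phiS sw _.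
    by rewrite es; exists u; split=> //; apply/(IHa u suba pu); rewrite -es.
  exists (trace u); split; first by apply: t_step; exists u, w.
  exact/IHa.
Qed.

End Filtration.

(** * Completeness *)

Lemma finite_completeness phi :
  (forall (X : finType) (F : temporal_transit X), valid F phi) -> tHC phi.
Proof.
move=> h; apply: NNPP => nphi.
(* An unprovable [phi] keeps [tHC] apart from the formulas below [phi]; a prime theory avoiding
   these has a trace that refutes [phi]. *)
have [c tc cphi|w [pw _ dw]] := prime_extension theory_tHC (ideal_below phi).
  by apply: nphi; apply: tHC_mp cphi tc.
apply: (dw phi); last exact: theory_id theory_tHC.
apply/(filt_truth (S := subforms phi) _ pw) => //.
by apply: h => n; apply: filt_val_upset.
Qed.

Theorem theorem6p13 (phi : form) :
  tHC phi <->
  (forall (X : finType) (F : temporal_transit X), Z_rooted F -> valid F phi).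
Proof.
split=> [h X F _|h]; first exact: valid_tHC.
by apply: finite_completeness => X F; apply: Z_rooted_valid.
Qed.
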